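(* Let $E=\bigsqcup_{v\in V}\delta(v)$ be a partition of a finite set, $n=|V|$, let $M=(E,\mathcal I)$ be a matroid, and suppose each $v\in V$ has a weak ranking $\succ_v$ on $\delta(v)$. Then the popular common independent set polytope, i.e., the convex hull in $\mathbb R^E$ of the incidence vectors of all popular common independent sets, is a projection of a face of a matroid intersection polytope. Specifically, let $E'=E\cup\{e_v:v\in V\}$ with new elements $e_v$, let $P$ be the partition matroid on $E'$ with blocks $\delta(v)\cup\{e_v\}$ ($v\in V$), and let $M'$ be the matroid on $E'$ whose independent sets are those $X\subseteq E'$ with $X\cap E\in\mathcal I$ and $|X|\le n$; then there is a face of the convex hull of incidence vectors of common independent sets of $P$ and $M'$ whose image under the coordinate projection $\mathbb R^{E'}\to\mathbb R^{E}$ equals the popular common independent set polytope.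
   Context: A weak ranking is a partial order $\succ_v$ (irreflexive, transitive) such that the indifference relation $e\sim_v f$ (meaning neither $e\succ_v f$ nor $f\succ_v e$) is transitive. A common independent set is a set $I\in\mathcal I$ with $|I\cap\delta(v)|\le 1$ for all $v$. For common independent sets $I,I'$, $v$ prefers $I$ to $I'$ if either $I\cap\delta(v)\ne\emptyset=I'\cap\delta(v)$, or $I\cap\delta(v)=\{e\}$, $I'\cap\delta(v)=\{f\}$ with $e\succ_v f$; $\phi(I,I')$ is the number of such $v$; $I$ is popular if $\phi(I,I')\ge\phi(I',I)$ for all common independent sets $I'$. *)

(* Defs.v *)
From HB Require Import structures.
From mathcomp Require Import all_boot all_order all_algebra.
From mathcomp Require Import reals.
Set Implicit Arguments. Unset Strict Implicit. Unset Printing Implicit Defensive.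
Import Order.TTheory GRing.Theory Num.Theory.
Local Open Scope ring_scope.

Definition matroid (T : finType) (Ind : pred {set T}) : Prop :=
  [/\ Ind set0,
      (forall A B : {set T}, B \subset A -> Ind A -> Ind B) &
      (forall A B : {set T}, Ind A -> Ind B -> (#|A| < #|B|)%N ->
          exists2 e, e \in B :\: A & Ind (e |: A))].

(* The block delta(v) of the partition E = disjoint union of delta(v),
   encoded by the function part : E -> V sending e to the unique v with e in delta(v). *)
Definition delta (E V : finType) (part : E -> V) (v : V) : {set E} :=
  [set e | part e == v].

Definition weak_ranking (E : finType) (D : {set E}) (r : rel E) : Prop :=
  [/\ (forall e, e \in D -> ~~ r e e),
      (forall e f g, e \in D -> f \in D -> g \in D -> r e f -> r f g -> r e g) &
      (forall e f g, e \in D -> f \in D -> g \in D ->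
         ~~ r e f -> ~~ r f e -> ~~ r f g -> ~~ r g f -> ~~ r e g && ~~ r g e)].

Section Popular.
Variables (E V : finType) (part : E -> V) (Ind : pred {set E}) (pref : V -> rel E).

Definition common_indep (I : {set E}) : bool :=
  Ind I && [forall v, #|I :&: delta part v| <= 1]%N.

Definition prefers (v : V) (I J : {set E}) : bool :=
  ((I :&: delta part v != set0) && (J :&: delta part v == set0))
  || [exists e, exists f, [&& I :&: delta part v == [set e],
                               J :&: delta part v == [set f] & pref v e f]].

Definition phi (I J : {set E}) : nat := #|[set v | prefers v I J]|.

Definition popular (I : {set E}) : bool :=
  common_indep I && [forall J, common_indep J ==> (phi J I <= phi I J)%N].
End Popular.

Definition chi (R : realType) (T : finType) (S : {set T}) : {ffun T -> R} :=
  [ffun e => (e \in S)%:R].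

Definition conv_chi (R : realType) (T : finType) (Fam : pred {set T})
    (x : {ffun T -> R}) : Prop :=
  exists lam : {ffun {set T} -> R},
    [/\ (forall A, 0 <= lam A), (forall A, ~~ Fam A -> lam A = 0),
        \sum_A lam A = 1 & forall t, x t = \sum_A lam A * chi R A t].

Definition dotp (R : realType) (T : finType) (a x : {ffun T -> R}) : R :=
  \sum_t a t * x t.

(* F is a face of the polytope Q: the intersection of Q with a supporting
   hyperplane of a valid inequality a.x <= b (a = 0, b = 0 gives Q itself). *)
Definition is_face (R : realType) (T : finType) (Q F : {ffun T -> R} -> Prop) : Prop :=
  exists (a : {ffun T -> R}) (b : R),
    (forall x, Q x -> dotp a x <= b) /\
    (forall x, F x <-> (Q x /\ dotp a x = b)).

(* Extended ground set E' = E + {e_v : v in V}, with e_v = inr v. *)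
Definition P_indep (E V : finType) (part : E -> V) (X : {set E + V}) : bool :=
  [forall v, #|[set x in X | match x with inl e => part e == v | inr w => w == v end]| <= 1]%N.

Definition M'_indep (E V : finType) (Ind : pred {set E}) (X : {set E + V}) : bool :=
  Ind [set e | inl e \in X] && (#|X| <= #|V|)%N.

Definition proj_E (R : realType) (E V : finType) (x : {ffun E + V -> R}) : {ffun E -> R} :=
  [ffun e => x (inl e)].

(* Main.v *)
Require Import Defs.
From HB Require Import structures.
From mathcomp Require Import all_boot all_order all_algebra.
From mathcomp Require Import reals zify.
Import Order.TTheory GRing.Theory Num.Theory.

Set Implicit Arguments.
Unset Strict Implicit.
Unset Printing Implicit Defensive.

(** Call an element a first choice of [v] if it is a best non-loop of
    [delta v], and put [g(A) = r(A) + #{v : some first choice of v is not in A}],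
    which bounds the number of first choices in any common independent set.  Let
    [A] be a largest minimiser of [g].  Then a common independent set [I] is
    popular iff it contains [g(A)] first choices, every chosen element is a first
    choice or a best element of its block outside the closure of [A], and
    unmatched agents have their whole block inside that closure.  If [I] violates
    this, Rado's theorem yields a set that beats [I]; conversely these conditions
    make [r(closure A)] pay for every vote against [I].  After completing [I] by
    the elements [e_v], the three conditions say that a linear functional
    (size + first choices - forbidden elements) attains the upper bound
    [n + g(A)], which cuts out a face. *)

(** * Matroid rank, closure and Rado's theorem *)

Section MatroidRank.
Variables (E : finType) (Ind : pred {set E}).
Hypothesis matI : matroid Ind.
Implicit Types A B X Y Z : {set E}.

Definition rank A : nat := \max_(X : {set E} | (X \subset A) && Ind X) #|X|.

Lemma indep_sub A B : B \subset A -> Ind A -> Ind B.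
Proof. by case: matI => _ h _; apply: h. Qed.

Lemma leq_rank X A : Ind X -> X \subset A -> #|X| <= rank A.
Proof. by move=> iX sXA; rewrite /rank (bigD1 X) ?sXA //= leq_maxl. Qed.

Lemma rank_leP A n :
  reflect (forall X, X \subset A -> Ind X -> #|X| <= n) (rank A <= n).
Proof.
apply: (iffP idP) => [le X sXA iX | h]; first exact: leq_trans (leq_rank iX sXA) le.
by apply/bigmax_leqP => X /andP[]; apply: h.
Qed.

Lemma rank_mono A B : A \subset B -> rank A <= rank B.
Proof.
move=> sAB; apply/rank_leP => X sXA iX; apply: leq_rank => //.
exact: subset_trans sAB.
Qed.

Lemma rank_le_card A : rank A <= #|A|.
Proof. by apply/rank_leP => X sXA _; apply: subset_leq_card. Qed.

Lemma rank_witness A : exists X, [/\ X \subset A, Ind X & #|X| = rank A].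
Proof.
have h0 : (set0 \subset A) && Ind set0 by rewrite sub0set; case: matI.
exists [arg max_(X > set0 | (X \subset A) && Ind X) #|X|].
case: arg_maxnP => // X /andP[sXA iX] maxX; split=> //.
apply/eqP; rewrite eqn_leq leq_rank //=; apply/rank_leP => Y sYA iY.
by apply: maxX; rewrite sYA.
Qed.

Lemma indep_extend X Y : Ind X -> Ind Y -> #|X| <= #|Y| ->
  exists Z, [/\ X \subset Z, Z \subset X :|: Y, Ind Z & #|Z| = #|Y|].
Proof.
move=> iX iY; move: {2}(#|Y| - #|X|) (erefl (#|Y| - #|X|)) => k.
elim: k X iX => [|k IH] X iX ek le.
  by exists X; split=> //; [exact: subsetUl | lia].
have lt : #|X| < #|Y| by lia.
case: matI => _ _ /(_ _ _ iX iY lt)[e]; rewrite inE => /andP[eX eY] ieX.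
have c : #|e |: X| = #|X|.+1 by rewrite cardsU1 eX.
case: (IH _ ieX) => [||Z [s1 s2 iZ cZ]]; try lia.
exists Z; split=> //; first exact: subset_trans (subsetUr _ _) s1.
apply: subset_trans s2 _; rewrite -setUA subUset subxx andbT sub1set.
by rewrite !inE eY orbT.
Qed.

Lemma basis_extend X A : Ind X -> X \subset A ->
  exists Z, [/\ X \subset Z, Z \subset A, Ind Z & #|Z| = rank A].
Proof.
move=> iX sXA; case: (rank_witness A) => Y [sYA iY cY].
case: (@indep_extend X Y iX iY) => [|Z [s1 s2 iZ cZ]].
  by rewrite cY leq_rank.
exists Z; split=> //; last by rewrite cZ.
by apply: subset_trans s2 _; rewrite subUset sXA.
Qed.

(** A basis of the intersection, extended to a basis of the union, has independent traces on [A] and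
    on [B]. *)
Lemma rank_submod A B : rank (A :&: B) + rank (A :|: B) <= rank A + rank B.
Proof.
case: (rank_witness (A :&: B)) => X [sX iX cX].
case: (@basis_extend X (A :|: B) iX) => [|Z [sXZ sZ iZ cZ]].
  by apply: subset_trans sX _; apply: subset_trans (subsetIl _ _) (subsetUl _ _).
have hA : #|Z :&: A| <= rank A.
  by apply: leq_rank (subsetIr _ _); apply: indep_sub iZ; apply: subsetIl.
have hB : #|Z :&: B| <= rank B.
  by apply: leq_rank (subsetIr _ _); apply: indep_sub iZ; apply: subsetIl.
have := cardsUI (Z :&: A) (Z :&: B); rewrite -setIUr (setIidPl sZ).
have : #|X| <= #|(Z :&: A) :&: (Z :&: B)|.
  by apply: subset_leq_card; rewrite -setIIr subsetI sXZ.
lia.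
Qed.

Definition mclosure A : {set E} := [set e | rank (e |: A) == rank A].

Lemma sub_closure A : A \subset mclosure A.
Proof.
by apply/subsetP => e eA; rewrite inE (setUidPr _) // sub1set.
Qed.

(** An independent subset of the closure larger than a basis of [A] would, by exchange, enlarge that
    basis by an element of the closure. *)
Lemma rank_closure A : rank (mclosure A) = rank A.
Proof.
apply/eqP; rewrite eqn_leq (rank_mono (sub_closure A)) andbT.
apply/rank_leP => Y sYC iY; rewrite leqNgt; apply/negP => lt.
case: (rank_witness A) => X [sXA iX cX].
case: matI => _ _ /(_ _ _ iX iY); rewrite cX => /(_ lt)[e].
rewrite inE => /andP[eX eY] ieX.
have /eqP h : rank (e |: A) == rank A by have := subsetP sYC _ eY; rewrite inE.
have := leq_rank ieX (setUS [set e] sXA); rewrite h cardsU1 eX; lia.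
Qed.

(** By submodularity, adding an element of rank zero cannot raise the rank of [A]. *)
Lemma notin_closure_indep A e : e \notin mclosure A -> Ind [set e].
Proof.
rewrite inE; apply: contraNT => ni.
have := rank_submod [set e] A; have := rank_mono (subsetUr [set e] A).
suff : rank [set e] = 0 by lia.
apply/eqP; rewrite -leqn0; apply/rank_leP => X; rewrite subset1.
by case/orP => /eqP ->; [rewrite (negPf ni) | rewrite cards0].
Qed.

(* Deficiency form of Rado's theorem: the transversal is obtained by shrinking
   the family to members of size at most one, one element at a time. *)
Lemma rado_deficiency (U : finType) (F : U -> {set E}) (d : nat) :
  (forall K : {set U}, #|K| <= rank (\bigcup_(u in K) F u) + d) ->
  exists G : U -> {set E},
    [/\ (forall u, G u \subset F u), (forall u, #|G u| <= 1) &
        #|U| <= rank (\bigcup_u G u) + d].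
Proof.
move: {2}(\sum_u #|F u|) (leqnn (\sum_u #|F u|)) => m.
elim: m F => [|m IH] F szF hall.
  exists F; split=> // [u|].
    by move: szF; rewrite leqn0 sum_nat_eq0 => /forallP/(_ u)/eqP ->.
  by have := hall setT; rewrite cardsT; under eq_bigl do rewrite in_setT.
case: (boolP [forall u, #|F u| <= 1]) => [/forallP small|].
  exists F; split=> //.
  by have := hall setT; rewrite cardsT; under eq_bigl do rewrite in_setT.
rewrite negb_forall => /existsP[u]; rewrite -ltnNge => /card_gt1P[x [y [xF yF nxy]]].
pose del z w := if w == u then F u :\ z else F w.
have delS z w : del z w \subset F w.
  by rewrite /del; case: eqP => [->|_] //; apply: subsetDl.
have step z : z \in F u ->
    (forall K : {set U}, #|K| <= rank (\bigcup_(w in K) del z w) + d) ->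
    exists G : U -> {set E},
    [/\ (forall u, G u \subset F u), (forall u, #|G u| <= 1) &
        #|U| <= rank (\bigcup_u G u) + d].
  move=> zF hz; case: (IH (del z)) => //; last first.
    move=> G [s1 s2 s3]; exists G; split=> // w.
    exact: subset_trans (s1 w) (delS z w).
  have e1 H : \sum_w #|H w| = #|H u| + \sum_(w | w != u) #|H w| :> nat.
    by rewrite (bigD1 u).
  move: szF; rewrite !e1 {1}/del eqxx (cardsD1 z (F u)) zF.
  rewrite [in X in _ -> X](eq_bigr (fun w => #|F w|)) => [|w /negPf wu].
    by rewrite add1n addSn.
  by rewrite /del wu.
(* One of [x], [y] can be deleted from [F u]; otherwise there are violators [K1], [K2], and
   uncrossing them is contradictory. *)
pose viol z (K : {set U}) := rank (\bigcup_(w in K) del z w) + d < #|K|.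
case: (boolP [exists K, viol x K]) => [/existsP[K1 v1]|]; last first.
  rewrite negb_exists => /forallP h; apply: (step x) => // K.
  by have := h K; rewrite -leqNgt.
case: (boolP [exists K, viol y K]) => [/existsP[K2 v2]|]; last first.
  rewrite negb_exists => /forallP h; apply: (step y) => // K.
  by have := h K; rewrite -leqNgt.
have inK z K : viol z K -> u \in K.
  move=> v; apply: contraTT v => uK; rewrite -leqNgt.
  apply: leq_trans (hall K) _; rewrite leq_add2r; apply: rank_mono.
  apply/bigcupsP => w wK; rewrite (bigcup_max w) // /del.
  by case: eqP wK uK => // -> ->.
have u1 := inK _ _ v1; have u2 := inK _ _ v2.
have := rank_submod (\bigcup_(w in K1) del x w) (\bigcup_(w in K2) del y w).
(* No set indexed by [(K1 :&: K2) :\ u] was shrunk; counting [u] again costs the [+ 1]. *)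
have cI : #|K1 :&: K2| <=
    rank ((\bigcup_(w in K1) del x w) :&: (\bigcup_(w in K2) del y w)) + d + 1.
  rewrite (cardsD1 u) inE u1 u2 addnC leq_add2r.
  apply: leq_trans (hall _) _; rewrite leq_add2r; apply: rank_mono.
  apply/bigcupsP => w; rewrite !inE => /and3P[/negPf wu w1 w2].
  by rewrite subsetI !(bigcup_max w) // /del wu.
(* As [x != y], the two shrunken versions of [F u] together give back [F u]. *)
have cU : #|K1 :|: K2| <=
    rank ((\bigcup_(w in K1) del x w) :|: (\bigcup_(w in K2) del y w)) + d.
  apply: leq_trans (hall _) _; rewrite leq_add2r; apply: rank_mono.
  apply/bigcupsP => w; rewrite inE.
  have [-> _|wu] := eqVneq w u.
    apply/subsetP => z zF; rewrite inE; have [zx|zx] := eqVneq z x.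
      apply/orP; right; apply/bigcupP; exists u => //.
      by rewrite /del eqxx !inE zF zx nxy.
    apply/orP; left; apply/bigcupP; exists u => //.
    by rewrite /del eqxx !inE zF zx.
  case/orP => wK; apply/subsetP => z zF; rewrite inE; apply/orP; [left|right];
    by apply/bigcupP; exists w => //; rewrite /del (negPf wu).
have := cardsUI K1 K2; move: v1 v2; rewrite /viol; lia.
Qed.

End MatroidRank.

(** * Common independent sets and best elements of a block *)

Section PopularSets.
Variables (E V : finType) (part : E -> V) (Ind : pred {set E}).
Variable pref : V -> rel E.
Hypothesis matI : matroid Ind.
Hypothesis rankV : forall v, weak_ranking (delta part v) (pref v).
Implicit Types (A B G I J K L X : {set E}) (F : V -> {set E}).

Local Notation common := (common_indep part Ind).
Local Notation rk := (rank Ind).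

Lemma common_indepP I :
  reflect (Ind I /\ {in I &, injective part}) (common I).
Proof.
apply: (iffP andP) => -[iI h]; split=> //.
  move=> e f eI fI ef; have /forallP/(_ (part f))/card_le1_eqP := h.
  by apply; rewrite !inE ?eI ?fI ?ef eqxx.
apply/forallP => v; apply/card_le1_eqP => e f.
rewrite !inE => /andP[eI /eqP ev] /andP[fI /eqP fv].
by apply: h; rewrite ?ev ?fv.
Qed.

Lemma card_part I : common I -> forall K, K \subset I -> #|part @: K| = #|K|.
Proof.
case/common_indepP => _ inj K sKI; apply: card_in_imset => e f eK fK.
by apply: inj; apply: (subsetP sKI).
Qed.

Lemma delta_common I e : common I -> e \in I ->
  I :&: delta part (part e) = [set e].
Proof.
case/common_indepP => _ inj eI; apply/setP => f; rewrite !inE.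
apply/andP/eqP => [[fI /eqP ef]|->]; [exact: inj | by rewrite eI eqxx].
Qed.

(** Both clauses of [prefers] merge into one, since the condition on [f] is vacuous when [J] misses
    the block. *)
Lemma prefersP I J v : common I -> common J ->
  reflect (exists2 e, e \in I /\ part e = v &
             forall f, f \in J -> part f = v -> pref v e f)
          (prefers part pref v I J).
Proof.
move=> cI cJ; apply: (iffP orP).
  case=> [/andP[/set0Pn[e]]|/existsP[e /existsP[f /and3P[/eqP eI /eqP fJ ef]]]].
    rewrite !inE => /andP[eI /eqP ev] /eqP J0; exists e => // f fJ fv.
    by have := in_set0 f; rewrite -J0 !inE fJ fv eqxx.
  exists e; first by have := set11 e; rewrite -eI !inE => /andP[-> /eqP].
  move=> g gJ gv; have : g \in J :&: delta part v by rewrite !inE gJ gv eqxx.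
  by rewrite fJ => /set1P ->.
case=> e [eI ev] h; have [J0|/set0Pn[f]] := eqVneq (J :&: delta part v) set0.
  left; rewrite andbT; apply/set0Pn; exists e.
  by rewrite !inE eI ev eqxx.
rewrite !inE => /andP[fJ /eqP fv]; right; apply/existsP; exists e.
apply/existsP; exists f; rewrite h //.
by rewrite -{1}ev -fv !delta_common // !eqxx.
Qed.

Lemma pref_irr e : pref (part e) e e = false.
Proof.
by case: (rankV (part e)) => h _ _; apply/negbTE/h; rewrite inE.
Qed.

Lemma pref_trans v e f g : part e = v -> part f = v -> part g = v ->
  pref v e f -> pref v f g -> pref v e g.
Proof.
by move=> ev fv gv; case: (rankV v) => _ h _; apply: h; rewrite inE ?ev ?fv ?gv.
Qed.

Definition best (P : pred E) v : {set E} :=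
  [set e in delta part v | P e & [forall h in delta part v, P h ==> ~~ pref v h e]].

Lemma bestP (P : pred E) v e :
  reflect [/\ part e = v, P e & forall h, part h = v -> P h -> ~~ pref v h e]
          (e \in best P v).
Proof.
rewrite !inE; apply: (iffP and3P) => -[/eqP ev Pe h]; split=> //.
- move=> g gv; have /forall_inP/(_ g) := h.
  by rewrite inE gv eqxx => /(_ isT)/implyP.
- by apply/forall_inP => g; rewrite inE => /eqP gv; apply/implyP; apply: h.
Qed.

(** Take [g] with the fewest admissible elements above it; by transitivity and irreflexivity an
    admissible element above [g] would have fewer. *)
Lemma best_exists (P : pred E) v e : part e = v -> P e -> best P v != set0.
Proof.
move=> ev Pe; pose up g := [set h | (part h == v) && P h & pref v h g].
pose ok g := (part g == v) && P g.
have ok0 : ok e by rewrite /ok ev eqxx.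
case: (arg_minnP (fun g => #|up g|) ok0) => g /andP[/eqP gv Pg] ming.
apply/set0Pn; exists g; apply/bestP; split=> // h hv Ph; apply/negP => hg.
suff /ltn_geF : #|up h| < #|up g| by rewrite ming // /ok hv eqxx.
apply: proper_card; apply/properP; split.
  apply/subsetP => k; rewrite !inE => /andP[/andP[/eqP kv Pk] kh].
  by rewrite kv eqxx Pk; apply: (pref_trans kv hv gv kh hg).
exists h; first by rewrite inE hv eqxx Ph.
by rewrite inE -{2}hv pref_irr andbF.
Qed.

(** Transitivity of indifference enters here: some admissible [h] lies above [f], and if [e] did not
    beat [f], then [e] would be indifferent to both, making [h] indifferent to [f]. *)
Lemma best_strict (P : pred E) v e f : e \in best P v -> part f = v -> P f ->
  f \notin best P v -> pref v e f.
Proof.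
case/bestP => ev Pe eM fv Pf fN.
have [h [hv Ph hf]] : exists h, [/\ part h = v, P h & pref v h f].
  case: (boolP [exists h, [&& part h == v, P h & pref v h f]]).
    by case/existsP => h /and3P[/eqP hv Ph hf]; exists h.
  rewrite negb_exists => /forallP nh; case/negP: fN; apply/bestP; split=> // h hv Ph.
  by have := nh h; rewrite hv eqxx Ph.
apply: contraT => nef.
have nfe : ~~ pref v f e by apply: eM.
have nhe : ~~ pref v h e by apply: eM.
have [eh|neh] := boolP (pref v e h).
  by rewrite (pref_trans ev hv fv eh hf) in nef.
have [_ _ /(_ h e f)] := rankV v; rewrite !inE hv ev fv eqxx => /(_ isT isT isT).
by move=> /(_ nhe neh nef nfe); rewrite hf.
Qed.

(** * Covers bounding the number of chosen elements *)

Definition chosen F I : {set E} := [set e in I | e \in F (part e)].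

(** For first choices this is the function [g]. The family stays general because it is later
    modified at one agent. *)
Definition cover_value F A : nat := rk A + #|[set u | ~~ (F u \subset A)]|.

Lemma in_chosen F I e : (e \in chosen F I) = (e \in I) && (e \in F (part e)).
Proof. by rewrite inE. Qed.

Lemma chosen_sub F I : chosen F I \subset I.
Proof. by apply/subsetP => e; rewrite inE => /andP[]. Qed.

Lemma chosenD F I A :
  part @: (chosen F I :\: A) \subset [set u | ~~ (F u \subset A)].
Proof.
apply/subsetP => u /imsetP[e]; rewrite !inE => /and3P[eA _ eF] ->.
by apply: contraNN eA => /subsetP; apply.
Qed.

Lemma card_chosenD F I A : common I ->
  #|chosen F I :\: A| <= #|[set u | ~~ (F u \subset A)]|.
Proof.
move=> cI; rewrite -(card_part cI); first exact: subset_leq_card (chosenD F I A).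
exact: subset_trans (subsetDl _ _) (chosen_sub F I).
Qed.

Lemma rank_chosenI F I A : common I -> #|chosen F I :&: A| <= rk A.
Proof.
case/common_indepP => iI _; apply: leq_rank (subsetIr _ _).
by apply: indep_sub iI => //; apply: subset_trans (subsetIl _ _) (chosen_sub F I).
Qed.

Lemma card_chosen_le F I A : common I -> #|chosen F I| <= cover_value F A.
Proof.
move=> cI; rewrite -(cardsID A (chosen F I)).
by rewrite leq_add ?rank_chosenI ?card_chosenD.
Qed.

(** Complementary slackness: the bounds on the parts inside and outside [A] add up to the cover
    value, so both are attained. *)
Lemma chosen_tight F I A : common I -> cover_value F A <= #|chosen F I| ->
  #|chosen F I :&: A| = rk A /\
  forall u, ~~ (F u \subset A) -> exists2 e, e \in chosen F I :\: A & part e = u.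
Proof.
move=> cI; rewrite -(cardsID A (chosen F I)) /cover_value.
move=> le; have h1 := rank_chosenI F A cI; have h2 := card_chosenD F A cI.
split; first lia.
have sDI : chosen F I :\: A \subset I.
  exact: subset_trans (subsetDl _ _) (chosen_sub F I).
have /eqP eqS : part @: (chosen F I :\: A) == [set u | ~~ (F u \subset A)].
  by rewrite eqEcard chosenD (card_part cI) //; lia.
move=> u uN; have : u \in [set u | ~~ (F u \subset A)] by rewrite inE.
by rewrite -eqS => /imsetP[e he ->]; exists e.
Qed.

(** * A popular set attains the bound of some cover *)

Section Improvement.
Variables (F : V -> {set E}) (I : {set E}).
(** These properties abstract first choices; they also hold when one agent's set is replaced by a
    single element that it prefers to its share of [I]. *)
Hypothesis Fpart : forall u e, e \in F u -> part e = u.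
Hypothesis Fnonloop : forall u e, e \in F u -> Ind [set e].
Hypothesis popI : popular part Ind pref I.
Hypothesis Fmeet : forall e, e \in I -> F (part e) != set0.
Hypothesis Fbetter : forall e f, e \in I -> f \in F (part e) ->
  e \notin F (part e) -> pref (part e) f e.
Hypothesis Fmax : forall e f, e \in I -> f \in F (part e) ->
  e \in F (part e) -> ~~ pref (part e) e f.

Let I1 := chosen F I.
Let I2 := I :\: I1.
Let D : {set E} := [set e | e \in F (part e)].

Let commonI : common I. Proof. by case/andP: popI. Qed.

Let disjI2D e : e \in I2 -> e \in D = false.
Proof. by rewrite !inE => /andP[h1 h2]; move: h1; rewrite h2 => /negbTE. Qed.

(* Votes between [I] and [J] together with the part of [G] not in conflict
   with [J]. *)
Lemma improvement_bound J G : J \subset D -> {in J &, injective part} ->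
  G \subset I2 -> Ind (J :|: G) ->
  #|J| <= #|I1| + #|part @: (I2 :\: G) :\: part @: J|.
Proof.
move=> sJD injJ sGI2 iJG.
have sGI : G \subset I by apply: subset_trans sGI2 (subsetDl _ _).
have [_ injI] := common_indepP _ commonI.
pose L := J :|: [set g in G | part g \notin part @: J].
have cL : common L.
  apply/common_indepP; split.
    apply: indep_sub iJG => //; apply: setUS; apply/subsetP => g.
    by rewrite inE => /andP[].
  move=> e f; rewrite !inE => /orP[eJ|/andP[eG eN]] /orP[fJ|/andP[fG fN]] ef.
  - exact: injJ.
  - by rewrite -ef imset_f in fN.
  - by rewrite ef imset_f in eN.
  - by apply: injI => //; apply: (subsetP sGI).
have [_ /forallP/(_ L)/implyP/(_ cL) vote] := andP popI.
have gain : #|part @: J :\: part @: I1| <= phi part pref L I.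
  apply: subset_leq_card; apply/subsetP => u.
  rewrite in_setD => /andP[uN /imsetP[e eJ ue]]; rewrite inE.
  apply/(prefersP _ cL commonI); exists e; first by rewrite inE eJ.
  move=> f fI fu; rewrite -fu; apply: Fbetter => //.
    by have := subsetP sJD _ eJ; rewrite inE fu ue.
  by apply: contraNN uN => fF; rewrite -fu imset_f // inE fI.
(* By [Fbetter] and [Fmax] an agent served by [J] does not vote for [I]. The other losers lose a
   chosen element or a dropped element of [I2]. *)
have loss : phi part pref I L <=
    #|(part @: I1 :\: part @: J) :|: (part @: (I2 :\: G) :\: part @: J)|.
  apply: subset_leq_card; apply/subsetP => u.
  rewrite inE => /(prefersP _ commonI cL)[e [eI eu] h].
  have uJ : u \notin part @: J.
    apply/imsetP => -[j jJ uj].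
    have jF : j \in F (part e) by have := subsetP sJD _ jJ; rewrite inE -uj eu.
    have ej : pref (part e) e j by rewrite eu; apply: h; rewrite ?inE ?jJ.
    have [eF|eF] := boolP (e \in F (part e)).
      by have := Fmax eI jF eF; rewrite ej.
    have je := Fbetter eI jF eF; have := pref_irr e.
    by rewrite (pref_trans _ _ _ ej je) // -uj eu.
  rewrite in_setU !in_setD uJ /=.
  have [e1|e1] := boolP (e \in I1); first by rewrite -eu imset_f.
  apply/orP; right; rewrite -eu imset_f // 2!in_setD eI e1 !andbT.
  apply/negP => eG; have := pref_irr e; rewrite eu h //.
  by rewrite !inE eG eu uJ orbT.
have := leq_trans gain (leq_trans vote (leq_trans loss (leq_card_setU _ _))).
have cJ : #|part @: J| = #|J| by rewrite card_in_imset.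
have cI1 : #|part @: I1| = #|I1| by rewrite (card_part commonI) // chosen_sub.
have := cardsID (part @: I1) (part @: J); have := cardsID (part @: J) (part @: I1).
rewrite setIC cJ cI1; lia.
Qed.

(** A conflict makes the last term of [improvement_bound] strictly smaller than [#|I2 :\: G|], which
    forces [#|J| + #|G| < #|I|]. *)
Lemma no_conflicting_drop J G g : J \subset D -> {in J &, injective part} ->
  G \subset I2 -> Ind (J :|: G) -> #|I| <= #|J| + #|G| ->
  g \in I2 :\: G -> part g \notin part @: J.
Proof.
move=> sJD injJ sGI2 iJG le gD; apply/negP => gJ.
have := improvement_bound sJD injJ sGI2 iJG.
have : #|part @: (I2 :\: G) :\: part @: J| < #|part @: (I2 :\: G)|.
  apply: proper_card; apply/properP; split; first exact: subsetDl.
  by exists (part g); rewrite ?imset_f // inE gJ.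
have := leq_imset_card part (I2 :\: G).
have := cardsID G I2; rewrite (setIidPr sGI2).
have := cardsID I1 I; rewrite (setIidPr (chosen_sub F I)) -/I1 -/I2.
by lia.
Qed.

(* A dropped agent is compensated by one of its choices in [F], which costs at
   most one further element; hence nothing can be dropped. *)
Lemma no_drop J G : J \subset D -> {in J &, injective part} ->
  G \subset I2 -> Ind (J :|: G) -> #|I| <= #|J| + #|G| -> I2 :\: G = set0.
Proof.
move=> sJD injJ sGI2 iJG le; apply/eqP/set0Pn => -[g gD].
have gN := no_conflicting_drop sJD injJ sGI2 iJG le gD.
have [gI2 gG] : g \in I2 /\ g \notin G by move: gD; rewrite inE => /andP[].
have gI : g \in I by move: gI2; rewrite inE => /andP[].
have /set0Pn[f fF] := Fmeet gI.
have fg : part f = part g by apply: Fpart.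
have dJG : [disjoint J & G].
  rewrite disjoints_subset; apply/subsetP => e eJ; rewrite inE.
  apply/negP => eG; have := disjI2D (subsetP sGI2 _ eG).
  by rewrite (subsetP sJD _ eJ).
have cJG : #|J :|: G| = #|J| + #|G|.
  by have := leq_card_setU J G; rewrite dJG => -[_ /eqP].
have [|L [sfL sL iL cL]] := indep_extend matI (Fnonloop fF) iJG.
  rewrite cards1 cJG; apply: leq_trans le; apply/card_gt0P; by exists g.
have fD : f \in D by rewrite inE fg.
have fL : f \in L by apply: (subsetP sfL); rewrite set11.
have sub e : e \in L -> [\/ e = f, e \in J | e \in G].
  by move=> /(subsetP sL); rewrite !inE => /or3P[/eqP||]; [constructor 1|constructor 2|constructor 3].
have LD e : e \in L :&: D -> e = f \/ e \in J.
  rewrite inE => /andP[/sub[] // eG eD]; try by [left|right].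
  by have := disjI2D (subsetP sGI2 _ eG); rewrite eD.
have LI2 e : e \in L :&: I2 -> e \in G.
  rewrite inE => /andP[/sub[] // he /disjI2D]; first by rewrite he fD.
  by rewrite (subsetP sJD).
have fNJ e : e \in J -> part e != part f.
  by move=> eJ; apply: contraNN gN => /eqP; rewrite fg => <-; rewrite imset_f.
(* In the exchanged set [L] the element [g] is still dropped while [f] serves its agent, which
   [no_conflicting_drop] forbids. *)
have : part g \notin part @: (L :&: D).
  apply: (@no_conflicting_drop _ (L :&: I2)).
  - exact: subsetIr.
  - move=> e e' /LD[->|eJ] /LD[->|e'J] // ee; last exact: injJ.
      by have := fNJ _ e'J; rewrite ee eqxx.
    by have := fNJ _ eJ; rewrite ee eqxx.
  - exact: subsetIr.
  - by apply: indep_sub iL => //; rewrite -setIUr subsetIl.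
  - rewrite (leq_trans le) // -cJG -cL -(cardsID D L) leq_add2l.
    apply: subset_leq_card; apply/subsetP => e; rewrite !in_setD in_setI.
    move=> /andP[eD eL]; rewrite eL /=; case: (sub _ eL) => [ef|eJ|].
    + by rewrite ef fD in eD.
    + by rewrite (subsetP sJD _ eJ) in eD.
    + exact: (subsetP sGI2).
  - rewrite inE gI2 andbT; apply: contraNN gG; exact: LI2.
by rewrite -fg imset_f // inE fL.
Qed.

(* Rado's theorem for the family [F] extended by [#|I2| - 1] copies of [I2]
   produces a larger transversal of [F] that keeps almost all of [I2]. *)
Lemma popular_cover : exists A, cover_value F A <= #|chosen F I|.
Proof.
case: (boolP [exists A, cover_value F A <= #|chosen F I|]) => [/existsP //|].
rewrite negb_exists => /forallP noA.
have {}noA A : #|I1| < cover_value F A by rewrite ltnNge noA.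
pose k := #|I2|.
have cI : #|I1| + k = #|I|.
  by have := cardsID I1 I; rewrite (setIidPr (chosen_sub F I)).
have ltV : #|I1| < #|V|.
  apply: leq_trans (noA set0) _; rewrite /cover_value.
  have := rank_le_card Ind set0; rewrite cards0 leqn0 => /eqP ->.
  exact: max_card.
pose U := (V + 'I_k.-1)%type.
pose H (x : U) := if x is inl u then F u else I2.
(* The deficiency is chosen so that the transversal has at least [#|I1| + k = #|I|] elements if
   [k > 0], and [#|I1| + 1] if [k = 0]. *)
have [K|G [sGH G1 cG]] := @rado_deficiency _ _ matI U H (#|V| - #|I1| - 1).
  pose KV := [set u | inl u \in K]; pose KO := [set i | inr i \in K].
  pose A := \bigcup_(u in KV) F u.
  have cK : #|K| <= #|KV| + #|KO|.
    apply: (@leq_trans #|(inl @: KV :|: inr @: KO) : {set U}|).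
      apply: subset_leq_card; apply/subsetP => -[u|i] h; rewrite inE.
        by rewrite imset_f // inE.
      by apply/orP; right; rewrite imset_f // inE.
    apply: leq_trans (leq_card_setU _ _) _.
    by apply: leq_add; apply: leq_imset_card.
  have cN : #|[set u | ~~ (F u \subset A)]| + #|KV| <= #|V|.
    rewrite -(cardsC KV) addnC leq_add2l; apply: subset_leq_card.
    apply/subsetP => u; rewrite !inE; apply: contraNN => uK.
    by rewrite /A (bigcup_max u) // inE.
  have sA : A \subset \bigcup_(x in K) H x.
    apply/bigcupsP => u; rewrite inE => uK.
    exact: (bigcup_max (inl u)).
  have hA := noA A; rewrite /cover_value in hA.
  have rA := rank_mono Ind sA.
  (* Without copies of [I2] the assumption on covers suffices; with at least one copy, the union
     contains the independent set [(I1 :&: A) :|: I2]. *)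
  have [KO0|[i iKO]] := set_0Vmem KO; first by move: cK; rewrite KO0 cards0; lia.
  have cKO : #|KO| <= k.-1 by rewrite (leq_trans (max_card _)) ?card_ord.
  have gt0 : 0 < #|KO| by apply/card_gt0P; exists i.
  have sI2 : I2 \subset \bigcup_(x in K) H x.
    by apply: (bigcup_max (inr i)) => //; move: iKO; rewrite inE.
  have : #|(I1 :&: A) :|: I2| <= rk (\bigcup_(x in K) H x).
    apply: leq_rank; last first.
      by rewrite subUset sI2 andbT; apply: subset_trans (subsetIr _ _) sA.
    have [iI _] := common_indepP _ commonI; apply: indep_sub iI => //.
    rewrite subUset subsetDl andbT.
    exact: subset_trans (subsetIl _ _) (chosen_sub F I).
  have dis : (I1 :&: A) :&: I2 = set0.
    by apply/setP => e; rewrite in_set0 /I2 !in_setI in_setD; case: (e \in I1); rewrite ?andbF.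
  have := cardsUI (I1 :&: A) I2; rewrite dis cards0 -/k.
  have := card_chosenD F A commonI; rewrite -/I1.
  by have := cardsID A I1; lia.
have [J0 [sJ0 iJ0 cJ0]] := rank_witness matI (\bigcup_x G x).
rewrite card_sum card_ord -cJ0 in cG.
have J0D e : e \in J0 -> e \in D -> e \in G (inl (part e)).
  move=> /(subsetP sJ0)/bigcupP[[u|i] _ he] eD.
    by have /Fpart -> := subsetP (sGH (inl u)) _ he.
  by have := disjI2D (subsetP (sGH (inr i)) _ he); rewrite eD.
have J0N e : e \in J0 -> e \notin D -> e \in I2 /\ e \in \bigcup_i G (inr i).
  move=> /(subsetP sJ0)/bigcupP[[u|i] _ he] eD.
    have eF := subsetP (sGH (inl u)) _ he.
    by rewrite inE (Fpart eF) eF in eD.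
  split; first exact: (subsetP (sGH (inr i))).
  by apply/bigcupP; exists i.
pose J := J0 :&: D; pose G2 := J0 :\: D.
have sJD : J \subset D by apply: subsetIr.
have injJ : {in J &, injective part}.
  move=> e f; rewrite !in_setI => /andP[eJ eD] /andP[fJ fD] ef.
  have eG := J0D e eJ eD; have fG := J0D f fJ fD; rewrite ef in eG.
  by have /card_le1_eqP := G1 (inl (part f)); apply.
have sG2 : G2 \subset I2.
  by apply/subsetP => e; rewrite inE => /andP[eD eJ]; case: (J0N e).
have cG2 : #|G2| <= k.-1.
  apply: (@leq_trans #|\bigcup_(i : 'I_k.-1) G (inr i)|).
    apply: subset_leq_card; apply/subsetP => e.
    by rewrite inE => /andP[eD eJ]; case: (J0N e).
  rewrite [leqRHS](_ : _ = \sum_(i < k.-1) 1); last by rewrite sum1_card card_ord.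
  elim/big_rec2: _ => [|i n B _ IH]; first by rewrite cards0.
  by apply: leq_trans (leq_card_setU _ _) _; apply: leq_add.
have iJG : Ind (J :|: G2) by rewrite setID.
have cJG : #|J| + #|G2| = #|J0| by rewrite cardsID.
(* If [k = 0], then [J] beats [improvement_bound]. Otherwise [no_drop] puts all of [I2] into [G2],
   which has at most [k.-1] elements. *)
have [k0|kpos] := posnP k.
  have I20 : I2 = set0 by apply/eqP; rewrite -cards_eq0 -/k k0.
  have := improvement_bound sJD injJ sG2 iJG.
  by rewrite I20 set0D imset0 set0D cards0; lia.
have le : #|I| <= #|J| + #|G2| by lia.
have /eqP := no_drop sJD injJ sG2 iJG le; rewrite setD_eq0 => /subset_leq_card.
by rewrite -/k; lia.
Qed.

End Improvement.

(** * Certificates of popularity *)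

Definition first_choice v : {set E} := best (fun e => Ind [set e]) v.

Definition second_choice A v : {set E} := best (fun e => e \notin mclosure Ind A) v.

Definition certified A I : Prop :=
  [/\ cover_value first_choice A <= #|chosen first_choice I|,
      (forall e, e \in I -> e \in first_choice (part e) :|: second_choice A (part e)) &
      (forall v, v \notin part @: I -> delta part v \subset mclosure Ind A)].

Lemma common_nonloop I e : common I -> e \in I -> Ind [set e].
Proof.
by case/common_indepP => iI _ eI; apply: indep_sub iI => //; rewrite sub1set.
Qed.

(* Agents preferring [J] receive from [J] an element of the closure of [A],
   whose rank is already exhausted by the first choices in [I]. *)
Lemma certified_popular A I : common I -> certified A I ->
  popular part Ind pref I.
Proof.
move=> cI [tight inS unm]; rewrite /popular cI; apply/forallP => J.
apply/implyP => cJ; have [cA full] := chosen_tight cI tight.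
(* [T] has exactly [rk A] agents by tightness, and [TJ] at most that many; votes for [J] come from
   [TJ :\: T], and all of [T :\: TJ] votes for [I]. *)
pose T := part @: (chosen first_choice I :&: A).
pose TJ := part @: (J :&: mclosure Ind A).
have sT : chosen first_choice I :&: A \subset I.
  exact: subset_trans (subsetIl _ _) (chosen_sub first_choice I).
have [_ injI] := common_indepP _ cI.
have cT : #|T| = rk A by rewrite (card_part cI).
have cTJ : #|TJ| <= rk A.
  rewrite (card_part cJ) ?subsetIl // -(rank_closure matI).
  apply: leq_rank (subsetIr _ _); have [iJ _] := common_indepP _ cJ.
  by apply: indep_sub iJ => //; apply: subsetIl.
have loss : phi part pref J I <= #|TJ :\: T|.
  apply: subset_leq_card; apply/subsetP => v.
  rewrite inE => /(prefersP _ cJ cI)[f [fJ fv] h].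
  have noF e : e \in I -> part e = v -> e \notin first_choice v.
    move=> eI ev; apply/negP => /bestP[_ _ /(_ f fv (common_nonloop cJ fJ))].
    by rewrite h.
  rewrite in_setD; apply/andP; split.
    apply/imsetP => -[e]; rewrite in_setI in_chosen => /andP[/andP[eI eF] _] ve.
    by have := noF e eI (esym ve); rewrite ve eF.
  rewrite -fv imset_f // in_setI fJ /=.
  (* An unmatched agent has its whole block in the closure; a matched one holds a second choice
     here, and anything better lies in the closure. *)
  have [/imsetP[e eI ve]|/unm/subsetP] := boolP (v \in part @: I); last first.
    by apply; rewrite inE fv.
  have := inS e eI; rewrite in_setU -ve (negPf (noF e eI (esym ve))) /=.
  case/bestP => _ _ eS; apply: contraT => fC.
  by have := eS f fv fC; rewrite h.
have gain : #|T :\: TJ| <= phi part pref I J.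
  apply: subset_leq_card; apply/subsetP => v.
  rewrite in_setD => /andP[vTJ /imsetP[e eA ve]]; rewrite inE.
  have [eI eF eA'] : [/\ e \in I, e \in first_choice v & e \in A].
    by move: eA; rewrite in_setI in_chosen ve => /andP[/andP[]].
  apply/(prefersP _ cI cJ); exists e => // f fJ fv.
  apply: (best_strict eF fv); first exact: common_nonloop cJ fJ.
  apply: contraNN vTJ => fF; rewrite -fv imset_f // in_setI fJ /=.
  apply: (subsetP (sub_closure Ind A)).
  (* If some first choice of [v] were outside [A], tightness would give [v] an element of [I]
     outside [A], but its element [e] is in [A]. *)
  have [/subsetP|/full[e']] := boolP (first_choice v \subset A); first exact.
  rewrite in_setD => /andP[e'A e'I] e'v.
  have ee : e' = e.
    by apply: injI; rewrite ?(subsetP (chosen_sub _ _) _ e'I) // e'v.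
  by rewrite ee eA' in e'A.
apply: leq_trans loss (leq_trans _ gain).
have := cardsID TJ T; have := cardsID T TJ; rewrite setIC; lia.
Qed.

Definition optimal A : Prop :=
  (forall B, cover_value first_choice A <= cover_value first_choice B) /\
  (forall B, cover_value first_choice B <= cover_value first_choice A -> #|B| <= #|A|).

Lemma optimal_exists : exists A, optimal A.
Proof.
case: (arg_minnP (cover_value first_choice) (erefl : predT (set0 : {set E}))) => A0 _ min0.
pose P B := cover_value first_choice B <= cover_value first_choice A0.
case: (arg_maxnP (fun B => #|B|) (leqnn _ : P A0)) => A PA maxA; exists A.
split=> B; first exact: leq_trans PA (min0 B isT).
by move=> le; apply: maxA; apply: leq_trans le PA.
Qed.

Lemma first_choiceP v e : e \in first_choice v -> part e = v /\ Ind [set e].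
Proof. by case/bestP. Qed.

(** [popular_cover] yields some cover attained by [I], and [A] has the least value among all
    covers. *)
Lemma popular_first_tight I A : popular part Ind pref I -> optimal A ->
  cover_value first_choice A <= #|chosen first_choice I|.
Proof.
move=> popI [minA _]; have [cI _] := andP popI.
have [||||||B le] := @popular_cover first_choice I => //; last exact: leq_trans (minA B) le.
- by move=> u e /first_choiceP[].
- by move=> u e /first_choiceP[].
- by move=> e eI; apply: best_exists (erefl _) (common_nonloop cI eI).
- move=> e f eI fF eN; apply: best_strict fF (erefl _) _ eN.
  exact: common_nonloop cI eI.
- by move=> e f eI /bestP[_ _ h] _; apply: h => //; apply: common_nonloop cI eI.
Qed.

(* If some agent could get [f] outside the closure of [A], replacing its
   first choices by [f] and uncrossing the resulting cover with [A] would give a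
   larger optimal cover. *)
Lemma no_envied_outside I A v f : popular part Ind pref I -> optimal A ->
  (forall e, e \in chosen first_choice I -> part e != v) ->
  part f = v -> (forall e, e \in I -> part e = v -> pref v f e) ->
  f \in mclosure Ind A.
Proof.
move=> popI optA noF fv fbest; apply: contraT => fC.
have [cI _] := andP popI; have [minA maxA] := optA.
have tight := popular_first_tight popI optA.
pose F u := if u == v then [set f] else first_choice u.
have Fv : F v = [set f] by rewrite /F eqxx.
have FN u : u != v -> F u = first_choice u by rewrite /F => /negPf ->.
have fN : f \notin I.
  by apply/negP => fI; have := fbest f fI fv; rewrite -fv pref_irr.
have eqC : chosen F I = chosen first_choice I.
  apply/setP => e; rewrite !in_chosen; have [ev|nev] := eqVneq (part e) v.
    rewrite ev Fv in_set1; apply/andP/andP => -[eI]; first by move/eqP=> ef; rewrite -ef eI in fN.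
    by move=> eF; have := noF e; rewrite in_chosen eI ev eF eqxx => /(_ isT).
  by rewrite FN.
have [||||||B] := @popular_cover F I => //.
- by move=> u e; rewrite /F; case: eqP => [-> /set1P -> //|_ /first_choiceP[]].
- move=> u e; rewrite /F; case: eqP => [_ /set1P ->|_ /first_choiceP[] //].
  exact: notin_closure_indep fC.
- move=> e eI; rewrite /F; case: (part e =P v) => _; first by rewrite -cards_eq0 cards1.
  exact: best_exists (erefl _) (common_nonloop cI eI).
- move=> e g eI; rewrite /F; case: eqP => [ev /set1P -> _|_ gF eN].
    by rewrite ev; apply: fbest.
  by apply: best_strict gF (erefl _) _ eN; apply: common_nonloop cI eI.
- move=> e g eI; rewrite /F; case: eqP => [ev _ /set1P ef|_].
    by rewrite -ef eI in fN.
  by move=> /bestP[_ _ h] _; apply: h => //; apply: common_nonloop cI eI.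
rewrite eqC => leB; exfalso.
(* [N] leaves out [v]: as [v] holds no first choice in [I], the upper bound on chosen elements needs
   no term for it. *)
pose N A := [set u | u != v & ~~ (first_choice u \subset A)].
have sFA : first_choice v \subset A.
  have [_ full] := chosen_tight cI tight; apply: contraT => /full[e].
  by rewrite in_setD => /andP[_ /noF/eqP].
have coverN X : first_choice v \subset X ->
    cover_value first_choice X = rk X + #|N X|.
  move=> sX; rewrite /cover_value; congr (_ + _); apply: eq_card => u.
  rewrite [in LHS]inE [in RHS]inE.
  by case: eqP => [->|//]; rewrite sX.
have Nge X : #|chosen first_choice I| <= rk X + #|N X|.
  rewrite -(cardsID X (chosen first_choice I)) leq_add ?rank_chosenI //.
  rewrite -(card_part cI); last exact: subset_trans (subsetDl _ _) (chosen_sub _ _).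
  apply: subset_leq_card; apply/subsetP => u /imsetP[e eD ->].
  move: (eD); rewrite in_setD => /andP[_ /noF ev]; rewrite inE /= ev.
  have := subsetP (chosenD first_choice I X) _ (imset_f part eD).
  by rewrite inE.
(* If [f] is outside [B], the cover [B] pays an extra unit for [v], contradicting [Nge]. *)
have [fB|fB] := boolP (f \in B); last first.
  have sN : N B \subset [set u | ~~ (F u \subset B)] :\ v.
    by apply/subsetP => u; rewrite inE /= => /andP[uv uB]; rewrite !inE uv FN.
  have vF : v \in [set u | ~~ (F u \subset B)] by rewrite inE Fv sub1set.
  have := subset_leq_card sN; have := Nge B; move: leB.
  rewrite /cover_value (cardsD1 v [set u | ~~ (F u \subset B)]) vF; lia.
have eN : N B = [set u | ~~ (F u \subset B)].
  apply/setP => u; rewrite [in LHS]inE [in RHS]inE /=.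
  by have [->|uv] := eqVneq u v; rewrite ?Fv ?sub1set ?fB ?FN.
move: leB; rewrite /cover_value -eN => leB.
have sub := rank_submod matI A B.
have NI : #|N (A :&: B)| + #|N (A :|: B)| <= #|N A| + #|N B|.
  rewrite -[leqRHS]cardsUI; apply: leq_add; apply: subset_leq_card; apply/subsetP => u.
    rewrite in_setU !(inE, subsetI) /=; case: (u == v) => //=.
    by rewrite negb_and.
  rewrite in_setI [in X in X -> _]inE [u \in N A]inE [u \in N B]inE /=.
  case: (u == v) => //= nU; apply/andP; split; apply: contraNN nU => s.
    exact: subset_trans s (subsetUl _ _).
  exact: subset_trans s (subsetUr _ _).
have sFU : first_choice v \subset A :|: B by apply: subset_trans sFA (subsetUl _ _).
have := Nge (A :&: B); have := coverN A sFA; have := coverN _ sFU => cU cA geI.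
(* Uncrossing: the intersection still costs at least the common value by [Nge], so the union is a
   minimiser too, and it contains [f]. *)
have leU : cover_value first_choice (A :|: B) <= cover_value first_choice A.
  by have := card_chosen_le first_choice A cI; lia.
have := maxA _ leU; apply/negP; rewrite -ltnNge; apply: proper_card.
apply/properP; split; first exact: subsetUl.
exists f; first by rewrite inE fB orbT.
by apply: contraNN fC => /(subsetP (sub_closure Ind A)).
Qed.

(** [no_envied_outside] applies to unmatched agents and to agents holding no first choice. *)
Lemma popular_certified I A : popular part Ind pref I -> optimal A ->
  certified A I.
Proof.
move=> popI optA; have [cI _] := andP popI.
have tight := popular_first_tight popI optA.
have [cA _] := chosen_tight cI tight; have [iI injI] := common_indepP _ cI.
split=> // [e eI|v vI]; last first.
  apply/subsetP => f; rewrite inE => /eqP fv.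
  apply: (no_envied_outside popI optA _ fv) => [e /(subsetP (chosen_sub _ _)) eI|e eI ev].
    by apply: contraNN vI => /eqP <-; rewrite imset_f.
  by rewrite -ev imset_f in vI.
rewrite in_setU; have [//|eN /=] := boolP (e \in first_choice (part e)).
have eC : e \notin chosen first_choice I by rewrite in_chosen (negPf eN) andbF.
apply/bestP; split=> //.
  (* The chosen first choices inside [A] already exhaust the rank of its closure, leaving no room
     for [e]. *)
  apply/negP => eA.
  have : #|e |: (chosen first_choice I :&: A)| <= rk (mclosure Ind A).
    apply: leq_rank.
      apply: indep_sub iI => //; rewrite subUset sub1set eI.
      exact: subset_trans (subsetIl _ _) (chosen_sub _ _).
    rewrite subUset sub1set eA.
    exact: subset_trans (subsetIr _ _) (sub_closure Ind A).
  by rewrite cardsU1 in_setI (negPf eC) cA rank_closure //; lia.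
move=> h hv hC; apply: contraNN hC => he.
apply: (no_envied_outside popI optA _ hv) => [g gC|g gI gv].
  apply: contraNN eC => /eqP ge.
  by rewrite -(injI _ _ (subsetP (chosen_sub _ _) _ gC) eI ge).
by rewrite (injI _ _ gI eI gv).
Qed.

End PopularSets.

(** * Convex hulls of incidence vectors *)

Section FaceOfExtension.
Local Open Scope ring_scope.
Variable R : realType.

(** The weights are summed over the fibres of [h]. This serves both directions of the projection,
    with [complete] and with [restrict]. *)
Lemma conv_chi_push (T T' : finType) (P : pred {set T}) (Q : pred {set T'})
    (h : {set T} -> {set T'}) (lam : {ffun {set T} -> R}) :
  (forall A, 0 <= lam A) -> (forall A, ~~ P A -> lam A = 0) ->
  \sum_A lam A = 1 -> (forall A, P A -> Q (h A)) ->
  conv_chi Q [ffun t => \sum_A lam A * chi R (h A) t].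
Proof.
move=> lam0 lamP lam1 PQ.
have push (c : {set T'} -> R) :
    \sum_B (\sum_(A | h A == B) lam A) * c B = \sum_A lam A * c (h A).
  rewrite (partition_big h predT) //=; apply: eq_bigr => B _.
  by rewrite mulr_suml; apply: eq_bigr => A /eqP ->.
exists [ffun B => \sum_(A | h A == B) lam A]; split.
- by move=> B; rewrite ffunE; apply: sumr_ge0.
- move=> B nQB; rewrite ffunE big1 // => A /eqP hA; apply: lamP.
  by apply: contraNN nQB => /PQ; rewrite hA.
- rewrite -lam1; transitivity (\sum_B (\sum_(A | h A == B) lam A) * 1).
    by apply: eq_bigr => B _; rewrite ffunE mulr1.
  by rewrite (push (fun=> 1)); apply: eq_bigr => A _; rewrite mulr1.
- move=> t; rewrite ffunE -(push (fun B => chi R B t)).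
  by apply: eq_bigr => B _; rewrite [in RHS]ffunE.
Qed.

Lemma dotp_comb (S T : finType) (h : S -> {set T}) (lam : S -> R)
    (a x : {ffun T -> R}) :
  (forall t, x t = \sum_i lam i * chi R (h i) t) ->
  dotp a x = \sum_i lam i * \sum_(t in h i) a t.
Proof.
move=> xE; rewrite /dotp; under eq_bigr do rewrite xE mulr_sumr.
rewrite exchange_big /=; apply: eq_bigr => i _.
rewrite mulr_sumr [RHS]big_mkcond /=; apply: eq_bigr => t _.
by rewrite ffunE; case: (t \in h i); rewrite ?mulr1 ?mulr0 // mulrC.
Qed.

Lemma conv_value_le (T : finType) (P : pred {set T}) (a x : {ffun T -> R}) b :
  (forall A, P A -> \sum_(t in A) a t <= b) -> conv_chi P x -> dotp a x <= b.
Proof.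
move=> ub [lam [lam0 lamP lam1 xE]]; rewrite (dotp_comb a xE).
rewrite -[b]mul1r -lam1 mulr_suml; apply: ler_sum => A _.
have [PA|/lamP ->] := boolP (P A); last by rewrite !mul0r.
by rewrite ler_wpM2l // ub.
Qed.

(** The weighted slacks [lam B * (b - \sum_(t in B) a t)] are nonnegative and sum to zero, so each
    vanishes. *)
Lemma conv_value_eq (T : finType) (P : pred {set T}) (a x : {ffun T -> R}) b
    (lam : {ffun {set T} -> R}) :
  (forall A, P A -> \sum_(t in A) a t <= b) ->
  (forall A, 0 <= lam A) -> (forall A, ~~ P A -> lam A = 0) -> \sum_A lam A = 1 ->
  (forall t, x t = \sum_A lam A * chi R A t) -> dotp a x = b ->
  forall A, ~~ (P A && (\sum_(t in A) a t == b)) -> lam A = 0.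
Proof.
move=> ub lam0 lamP lam1 xE; rewrite (dotp_comb a xE) => eb A.
have [PA|/lamP //] := boolP (P A); rewrite /= => ne.
have : \sum_B lam B * (b - \sum_(t in B) a t) = 0.
  under eq_bigr do rewrite mulrBr.
  by rewrite sumrB -mulr_suml lam1 mul1r eb subrr.
move/eqP; rewrite psumr_eq0 => [|B _].
  move/allP/(_ A); rewrite mem_index_enum => /(_ isT); rewrite mulf_eq0 subr_eq0.
  by rewrite [b == _]eq_sym (negPf ne) orbF => /eqP.
have [PB|/lamP ->] := boolP (P B); last by rewrite mul0r.
by rewrite mulr_ge0 // subr_ge0 ub.
Qed.

(** * The face cut out by the popularity certificate *)

Variables (E V : finType) (part : E -> V) (Ind : pred {set E}).
Variable pref : V -> rel E.
Hypothesis matI : matroid Ind.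
Hypothesis rankV : forall v, weak_ranking (delta part v) (pref v).
Variable A : {set E}.
Hypothesis optA : optimal part Ind pref A.

Local Notation fst_ch := (first_choice part Ind pref).
Local Notation snd_ch := (second_choice part Ind pref A).
Local Notation fam := (fun X => P_indep part X && @M'_indep E V Ind X).

Implicit Types (X : {set E + V}) (I : {set E}).

Definition restrict X : {set E} := [set e | inl e \in X].

Definition complete I : {set E + V} :=
  [set x | match x with inl e => e \in I | inr v => v \notin part @: I end].

Definition owner (x : E + V) : V :=
  match x with inl e => part e | inr v => v end.

Definition top_items : {set E + V} :=
  [set x | if x is inl e then e \in fst_ch (part e) else false].

(** These encode the last two clauses of [certified]: taking [inr v] stands for leaving [v]
    unmatched. *)
Definition bad_items : {set E + V} :=
  [set x | match x with
           | inl e => e \notin fst_ch (part e) :|: snd_ch (part e)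
           | inr v => ~~ (delta part v \subset mclosure Ind A) end].

Definition face_normal : {ffun E + V -> R} :=
  [ffun x => 1 + (x \in top_items)%:R - (x \in bad_items)%:R].

Definition face_value : R := (#|V| + cover_value Ind fst_ch A)%:R.

Lemma P_indepP X : reflect {in X &, injective owner} (P_indep part X).
Proof.
have mem v x : (x \in [set x in X | match x with inl e => part e == v
    | inr w => w == v end]) = (x \in X) && (owner x == v).
  by rewrite inE; case: x.
apply: (iffP forallP) => [h x y xX yX xy | h v].
  by have /card_le1_eqP := h (owner y); apply; rewrite mem ?xX ?yX ?xy eqxx.
apply/card_le1_eqP => x y; rewrite !mem => /andP[xX /eqP xv] /andP[yX /eqP yv].
by apply: h => //; rewrite xv yv.
Qed.

Lemma sum_face_normal X : \sum_(x in X) face_normal x =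
  #|X|%:R + #|X :&: top_items|%:R - #|X :&: bad_items|%:R.
Proof.
under eq_bigr do rewrite ffunE.
have cnt (B : {set E + V}) : \sum_(x in X) (x \in B)%:R = #|X :&: B|%:R :> R.
  rewrite -sum1_card natr_sum [RHS]big_mkcond [LHS]big_mkcond /=.
  by apply: eq_bigr => x _; rewrite inE; case: (x \in X); case: (x \in B).
by rewrite sumrB big_split /= !cnt sumr_const.
Qed.

Lemma fam_common X : fam X -> common_indep part Ind (restrict X).
Proof.
case/andP => /P_indepP inj /andP[iX _]; apply/common_indepP; split=> //.
move=> e f; rewrite !inE => eX fX ef.
by have [] : inl e = inl f :> E + V by apply: inj.
Qed.

Lemma card_top X : #|X :&: top_items| = #|chosen part fst_ch (restrict X)|.
Proof.
rewrite -(card_imset _ (@inl_inj E V)); congr #|pred_of_set _|; apply/setP => x.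
apply/idP/imsetP => [|[e]].
  rewrite in_setI [x \in top_items]inE; case: x => [e|v]; last by rewrite andbF.
  by move=> /andP[eX eF]; exists e; rewrite // in_chosen eF inE eX.
rewrite in_chosen inE => /andP[eX eF] ->.
by rewrite in_setI eX [_ \in top_items]inE.
Qed.

Lemma fam_card X : fam X -> (#|X| <= #|V|)%N.
Proof. by case/andP => _ /andP[]. Qed.

Lemma fam_top X : fam X ->
  (#|X :&: top_items| <= cover_value Ind fst_ch A)%N.
Proof. by move=> fX; rewrite card_top card_chosen_le // fam_common. Qed.

Lemma face_valid X : fam X -> \sum_(x in X) face_normal x <= face_value.
Proof.
move=> fX; rewrite sum_face_normal /face_value natrD lerBlDr -!natrD ler_nat.
have := fam_card fX; have := fam_top fX; lia.
Qed.

(** Equality forces full size, tight first choices and no bad item, so the restriction is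
    certified. *)
Lemma face_popular X : fam X -> \sum_(x in X) face_normal x = face_value ->
  popular part Ind pref (restrict X).
Proof.
move=> fX; rewrite sum_face_normal /face_value => /eqP.
rewrite subr_eq -!natrD eqr_nat => /eqP eX.
have cX := fam_card fX; have tX := fam_top fX.
have bad0 : X :&: bad_items = set0 by apply/eqP; rewrite -cards_eq0; lia.
have good x : x \in X -> x \notin bad_items.
  move=> xX; apply/negP => xB; have := in_set0 x.
  by rewrite -bad0 in_setI xX xB.
have geX : (#|V| <= #|X|)%N by lia.
have [/P_indepP inj _] := andP fX.
apply: (certified_popular matI rankV (fam_common fX) (A := A)); split.
- by rewrite -card_top; lia.
- by move=> e; rewrite inE => /good; rewrite inE negbK.
(* A set of size [#|V|] with injective [owner] meets every block, so an unmatched [v] is represented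
   by [inr v]. *)
- move=> v vN; suff /good : inr v \in X by rewrite inE negbK.
  have /eqP full : owner @: X == setT.
    by rewrite eqEcard subsetT cardsT card_in_imset.
  have : v \in owner @: X by rewrite full inE.
  case/imsetP => -[e|w] xX /= vx; last by rewrite vx.
  by rewrite vx imset_f // inE in vN.
Qed.

Lemma restrict_complete I : restrict (complete I) = I.
Proof. by apply/setP => e; rewrite !inE. Qed.

(** Completion meets each block exactly once, giving size [#|V|]; the certificate supplies tightness
    and excludes bad items. *)
Lemma complete_face I : popular part Ind pref I ->
  fam (complete I) && (\sum_(x in complete I) face_normal x == face_value).
Proof.
move=> popI; have [cI _] := andP popI; have [iI injI] := common_indepP _ _ _ cI.
have inj : {in complete I &, injective owner}.
  move=> [e|v] [f|w]; rewrite !inE /= => h1 h2 eq.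
  - by congr inl; apply: injI.
  - by rewrite -eq imset_f in h2.
  - by rewrite eq imset_f in h1.
  - by rewrite eq.
have full : owner @: complete I = setT.
  apply/setP => v; rewrite in_setT; have [/imsetP[e eI ->]|vN] := boolP (v \in part @: I).
    by apply/imsetP; exists (inl e); rewrite ?inE.
  by apply/imsetP; exists (inr v); rewrite ?inE.
have card : #|complete I| = #|V|.
  by rewrite -(card_in_imset inj) full cardsT.
have [tight good unm] := popular_certified matI rankV popI optA.
have fI : fam (complete I).
  rewrite /M'_indep card leqnn andbT -/(restrict _) restrict_complete iI andbT.
  exact/P_indepP.
have bad0 : complete I :&: bad_items = set0.
  apply/setP => x; rewrite in_setI in_set0; apply/negbTE/negP => /andP[].
  case: x => [e|v]; rewrite [_ \in complete _]inE [_ \in bad_items]inE.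
    by move=> /good ->.
  by move=> /unm ->.
rewrite fI sum_face_normal bad0 cards0 subr0 card -natrD eqr_nat card_top.
rewrite restrict_complete eqn_add2l eqn_leq tight andbT.
exact: card_chosen_le.
Qed.

Lemma popular_polytope_is_projected_face :
  exists F : {ffun E + V -> R} -> Prop,
    is_face (conv_chi fam) F /\
    (forall y : {ffun E -> R},
       conv_chi (popular part Ind pref) y <-> exists2 x, F x & proj_E x = y).
Proof.
exists (fun x => conv_chi fam x /\ dotp face_normal x = face_value); split.
  exists face_normal, face_value; split=> // x; apply: conv_value_le.
  exact: face_valid.
move=> y; split.
  move=> [lam [lam0 lamP lam1 yE]].
  exists [ffun t => \sum_I lam I * chi R (complete I) t]; last first.
    apply/ffunP => e; rewrite !ffunE yE; apply: eq_bigr => I _.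
    by rewrite !ffunE !inE.
  split.
    by apply: (conv_chi_push lam0 lamP lam1) => I /complete_face/andP[].
  rewrite (dotp_comb (h := complete) (lam := lam)) => [|t]; last by rewrite ffunE.
  rewrite -[RHS]mul1r -lam1 mulr_suml; apply: eq_bigr => I _.
  have [/complete_face/andP[_ /eqP -> //]|/lamP ->] := boolP (popular part Ind pref I).
  by rewrite !mul0r.
(* The weights of a point of the face sit on sets attaining [face_value], whose restrictions are
   popular. *)
case=> x [[lam [lam0 lamP lam1 xE]] eb] <-.
have -> : proj_E x = [ffun e => \sum_X lam X * chi R (restrict X) e].
  apply/ffunP => e; rewrite !ffunE xE; apply: eq_bigr => X _.
  by rewrite !ffunE inE.
apply: (conv_chi_push lam0 (conv_value_eq face_valid lam0 lamP lam1 xE eb) lam1).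
by move=> X /andP[fX /eqP eX]; apply: face_popular.
Qed.

End FaceOfExtension.

Local Open Scope ring_scope.

Theorem theorem1p4 (R : realType) (E V : finType) (part : E -> V)
    (Ind : pred {set E}) (pref : V -> rel E) :
  matroid Ind ->
  (forall v, weak_ranking (delta part v) (pref v)) ->
  exists F : {ffun E + V -> R} -> Prop,
    is_face (conv_chi (fun X => P_indep part X && @M'_indep E V Ind X)) F /\
    (forall y : {ffun E -> R},
       conv_chi (popular part Ind pref) y <-> exists2 x, F x & proj_E x = y).
Proof.
move=> matI rankV; have [A optA] := optimal_exists part Ind pref.
exact (popular_polytope_is_projected_face R matI rankV optA).
Qed.
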